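(* Let $(p_j)_{j\ge 1}$ be a sequence of real numbers with $p_j>1/2$ for every $j=1,2,\dots$, and let $(\mu_j)_{j\ge1}$ be a sequence of real numbers. If $$\sum_{p_j>1}\frac{1}{p_j}+\sum_{1/2<p_j<1}\frac{2p_j-1}{p_j}=\infty,$$ where the sums run over the indices $j$ with $p_j>1$ and with $1/2<p_j<1$ respectively, then the problem of finding $f\in L^2_\rho(0,\infty)$ satisfying $$\int_0^\infty e^{-p_jx}f(x)\,dx=\mu_j\qquad\text{for all } j=1,2,3,\dots$$ has at most one solution in $L^2_\rho(0,\infty)$.
   Context: $L^2_\rho(0,\infty)$ is the Hilbert space of real Lebesgue measurable functions $f$ on $(0,\infty)$ with $\|f\|^2_{L^2_\rho}=\int_0^\infty |f(x)|^2e^{-x}\,dx<\infty$, with inner product $\langle f,g\rangle=\int_0^\infty f(x)g(x)e^{-x}\,dx$.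
   Formalization: The numbers p_j are assumed pairwise distinct; without this the claim is false, e.g. p_j = 2 and μ_j = 0 for all j makes the sum diverge, while every f orthogonal to e^{-x} is a solution. *)

(* Defs.v *)
(* MathComp-Analysis, over an arbitrary [R : realType]. *)
From HB Require Import structures.
From mathcomp Require Import all_boot all_order all_algebra.
From mathcomp Require Import all_classical all_reals all_analysis.

Set Implicit Arguments.
Unset Strict Implicit.
Unset Printing Implicit Defensive.
Import Order.TTheory GRing.Theory Num.Theory.
Import numFieldNormedType.Exports.

Local Open Scope classical_set_scope.
Local Open Scope ring_scope.

(* The real line with the sigma-algebra of Lebesgue measurable sets, i.e. the
   domain of [completed_lebesgue_measure]; the library's default measurable
   structure on [R] is the Borel one. *)
Notation lebesgueTypeR R := (caratheodory_type (wlength (@idfun R))^*%mu).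

(* The half-line (0, +oo). Functions on it are represented by total functions
   on [R] whose values elsewhere are irrelevant. *)
Definition posline (R : realType) : set (lebesgueTypeR R) := `]0%R, +oo[%classic.
Arguments posline R : clear implicits.

Definition integral_posline (R : realType) (h : R -> R) : \bar R :=
  (\int[@completed_lebesgue_measure R]_(x in posline R) (h x)%:E)%E.

(* The members of L^2_rho(0, +oo) are the classes of the functions in this set
   modulo [eq_L2rho]. *)
Definition L2rho (R : realType) : set (R -> R) :=
  [set f : R -> R |
    @measurable_fun _ _ (lebesgueTypeR R) (measurableTypeR R) (posline R) f /\
    (integral_posline (fun x : R => `|f x| ^+ 2 * expR (- x))%R < +oo)%E].

Definition eq_L2rho (R : realType) (f g : R -> R) : Prop :=
  {ae @completed_lebesgue_measure R, forall x, posline R x -> f x = g x}.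

(* For [0 < p j - 1 / 2] and [f] in [L2rho R] the integrand is integrable, by
   the Cauchy-Schwarz inequality. *)
Definition solves_moments (R : realType) (p mu : nat -> R) (f : R -> R) : Prop :=
  forall j, integral_posline (fun x : R => expR (- (p j * x)) * f x) = (mu j)%:E.

(* Main.v *)
Require Import Defs.
From HB Require Import structures.
From mathcomp Require Import all_boot all_order all_algebra.
From mathcomp Require Import all_classical all_reals all_analysis.
From mathcomp Require Import measurable_realfun ring lra.
Import Order.TTheory GRing.Theory Num.Theory.
Import numFieldNormedType.Exports.

(** Put [w x = (f x - g x) * exp (- x / 2)] and [a_j = p_j - 1/2 > 0]. Then [w]
is square integrable on the half-line for Lebesgue measure, and its Laplace
transform [L s], the integral of [exp (- s x) w x], vanishes at every [a_j].
Two facts have to be shown: [L] vanishes at every [z > 0], and a square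
integrable function whose Laplace transform vanishes is null.

The first fact is the real-variable shadow of Blaschke's condition: [L] belongs
to the Hardy space of the right half-plane, and dividing out the zeros
[a_0, ..., a_(n-1)] with the factors [(s - a_i) / (s + a_i)], unimodular on the
boundary, does not change its norm. Complex analysis can be avoided because the
adjoint of this division acts on exponential sums by an explicit formula. If
[z] is not itself a zero, it turns [exp (- z x)] into a combination of
[exp (- z x)] and the [exp (- a_i x)] that has the same norm, [(2 z)^(-1/2)],
and whose coefficient at [exp (- z x)] is the product [P_n] of the
[(z + a_i) / (z - a_i)] ([blaschke_gram]). Pairing this sum with [w] kills all
terms but the first, so [P_n * L z] stays bounded as [n] grows
([laplace_bound]). Since the square of [(z + a) / (z - a)] is
[1 + 4 z a / (z - a)^2], the number [P_n ^ 2] is at least [4 z] times the sum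
of the first [n] terms [a_i / (z + a_i)^2]. The divergence hypothesis makes
this sum unbounded ([moments_diverge]), hence [L z = 0] ([laplace_eq0]).

For the second fact, the exponential polynomials
[(1 - exp (- n c x)) ^ (2 ^ n)], with [exp (- c T) = 1/2], take values in
[[0, 1]] and converge to the indicator of the ray beyond [T]. By dominated
convergence the integral of [exp (- x) w x] over every such ray is [0]
([laplace_ray_eq0]), and rays generate the measurable sets up to null sets
([ae_eq0_of_rays]). *)

Set Implicit Arguments.
Unset Strict Implicit.
Unset Printing Implicit Defensive.

Local Open Scope classical_set_scope.
Local Open Scope ring_scope.

Local Notation lebT R := (lebesgueTypeR R).
Local Notation lambda R := (@completed_lebesgue_measure R).

(** * Blaschke products and Gram matrices of exponentials *)

(** [1 / (b i + b j)] is the inner product of [exp (- b i x)] and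
[exp (- b j x)] on the half-line, so the double sum is a squared norm. The sum
for [n.+1] is obtained from the sum for [n] by applying the linear map that
sends [exp (- s x)] to
[(s + a) / (s - a) exp (- s x) - 2 a / (s - a) exp (- a x)], where
[a = b n.+1]; this map preserves inner products. *)
Lemma blaschke_gram (R : realFieldType) (b : nat -> R) (n : nat) :
  injective b -> (forall i, 0 < b i) ->
  exists c : nat -> R,
    c 0 = \prod_(i < n) ((b 0 + b i.+1) / (b 0 - b i.+1)) /\
    \sum_(i < n.+1) \sum_(j < n.+1) c i * c j / (b i + b j) = (2 * b 0)^-1.
Proof.
move=> b_inj b_gt0; elim: n => [|n [c [c0 cG]]].
  exists (fun=> 1); split; first by rewrite big_ord0.
  rewrite !big_ord_recl !big_ord0 !addr0 mulr1 div1r.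
  by rewrite -[2]/(1 + 1) mulrDl mul1r.
pose a := b n.+1.
pose U := \sum_(i < n.+1) c i / (b i - a).
pose c' i :=
  if (i < n.+1)%N then c i * (b i + a) / (b i - a) else - (2 * a * U).
have c'E (i : 'I_n.+1) : c' i = c i * (b i + a) / (b i - a).
  by rewrite /c' ltn_ord.
have c'a : c' n.+1 = - (2 * a * U) by rewrite /c' ltnn.
have ba (i : 'I_n.+1) : b i - a != 0.
  by rewrite subr_eq0 (inj_eq b_inj) neq_ltn ltn_ord.
have bD i j : b i + b j != 0 by rewrite gt_eqF ?addr_gt0.
exists c'; split.
  by rewrite big_ord_recr /= -c0 (c'E ord0) mulrA.
have cross s : \sum_(i < n.+1) c' i * s / (b i + a) = s * U.
  rewrite mulr_sumr; apply: eq_bigr => i _.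
  by rewrite c'E; field; rewrite bD ba.
(* The terms that involve the new exponent add up to [- 2 a U^2], and cancel
what the factors of the new coefficients add to the old terms. *)
rewrite big_ord_recr /=; under eq_bigr do rewrite big_ord_recr /=.
rewrite big_split /= cross [X in _ + X]big_ord_recr /=.
have -> : \sum_(i < n.+1) c' n.+1 * c' i / (b n.+1 + b i) = c' n.+1 * U.
  rewrite -cross; apply: eq_bigr => i _.
  by rewrite (mulrC (c' _)) (addrC (b _)).
have -> : c' n.+1 * c' n.+1 / (b n.+1 + b n.+1) = 2 * a * U ^+ 2.
  by rewrite c'a -/a; field; rewrite -mulr2n mulrn_eq0 /= gt_eqF ?b_gt0.
rewrite c'a -cG.
have -> z : z + - (2 * a * U) * U + (- (2 * a * U) * U + 2 * a * U ^+ 2) =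
    z - 2 * a * U ^+ 2 by ring.
have -> : 2 * a * U ^+ 2 = \sum_(i < n.+1) \sum_(j < n.+1)
    2 * a * (c i / (b i - a) * (c j / (b j - a))).
  rewrite expr2 big_distrlr mulr_sumr; apply: eq_bigr => i _.
  by rewrite mulr_sumr.
rewrite -sumrB; apply: eq_bigr => i _; rewrite -sumrB; apply: eq_bigr => j _.
by rewrite !c'E; field; rewrite !ba bD.
Qed.

(** * Exponentials on the half-line for the completed Lebesgue measure *)

Lemma measurable_borel_lebesgue (R : realType) (A : set R) :
  @measurable _ (measurableTypeR R) A -> @measurable _ (lebT R) A.
Proof. exact: sub_caratheodory. Qed.

Lemma measurable_fun_borel_lebesgue (R : realType) (D : set R) (f : R -> R) :
  @measurable_fun _ _ (measurableTypeR R) (measurableTypeR R) setT f ->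
  @measurable_fun _ _ (lebT R) (measurableTypeR R) D f.
Proof.
move=> mf mD B mB; apply: measurableI => //.
apply: measurable_borel_lebesgue.
by rewrite -[X in measurable X]setTI; exact: mf.
Qed.

Lemma measurable_posline (R : realType) : measurable (posline R).
Proof. by apply: measurable_borel_lebesgue; exact: measurable_itv. Qed.

Lemma borel_measurable_expRM (R : realType) (s : R) :
  @measurable_fun _ _ (measurableTypeR R) (measurableTypeR R) setT
    (fun x : R => expR (- (s * x))).
Proof.
apply: measurableT_comp; first exact: measurable_expR.
by apply: measurable_funN; apply: measurable_funM.
Qed.

Lemma measurable_expRM (R : realType) (D : set R) (s : R) :
  @measurable_fun _ _ (lebT R) (measurableTypeR R) D
    (fun x : R => expR (- (s * x))).
Proof.
by apply: measurable_fun_borel_lebesgue; exact: borel_measurable_expRM.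
Qed.

(** The completed measure and the Borel one have the same values on Borel sets,
so the integral is the total mass of the exponential distribution, up to the
factor [s]. *)
Lemma integral_expR_posline (R : realType) (s : R) : 0 < s ->
  (\int[lambda R]_(x in posline R) (expR (- (s * x)))%:E = (s^-1)%:E)%E.
Proof.
move=> s0.
pose id' : lebT R -> measurableTypeR R := idfun.
have mid : measurable_fun setT id'.
  by move=> _ B mB; rewrite setTI; exact: measurable_borel_lebesgue.
have mEE (D : set R) : @measurable_fun _ _ (measurableTypeR R) _ D
   (fun x : R => (expR (- (s * x)))%:E).
  apply/measurable_EFinP; apply: measurable_funTS.
  exact: borel_measurable_expRM.
transitivity (\int[@lebesgue_measure R]_(x in `]0%R, +oo[)
    (expR (- (s * x)))%:E)%E.
  rewrite -(@ge0_integral_pushforward _ _ _ _ R id' mid (lambda R) `]0%R, +oo[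
    (fun x : R => (expR (- (s * x)))%:E)).
  - by apply: eq_measure_integral => A mA _.
  - exact: measurable_itv.
  - exact: mEE.
  - by move=> y _; rewrite lee_fin expR_ge0.
(* The exponential density is supported on the closed half-line. *)
rewrite integral_itv_obnd_cbnd; last exact: mEE.
rewrite -[LHS]mul1e.
have -> : (1 = (s^-1)%:E * s%:E :> \bar R)%E by rewrite -EFinM mulVf ?lt0r_neq0.
rewrite -muleA.
rewrite -ge0_integralZl//=; last by rewrite lee_fin ltW.
rewrite (_ : integral _ _ _ = 1%E) ?mule1//.
rewrite -(integral_exponential_pdf s0) [LHS]integral_mkcond.
apply: eq_integral => x _; rewrite /exponential_pdf !patchE.
by case: ifP => // _; rewrite EFinM mulNr.
Qed.

(** * Integrals of linear combinations *)

Lemma integrable_lincomb d (T : measurableType d) (R : realType)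
    (m : {measure set T -> \bar R}) (D : set T) (n : nat) (c : nat -> R)
    (f : nat -> T -> R) :
  measurable D -> (forall i, m.-integrable D (EFin \o f i)) ->
  m.-integrable D (EFin \o (fun x => \sum_(i < n) c i * f i x)).
Proof.
move=> mD fi; apply: (@eq_integrable _ _ _ m D mD
    (fun x => (\sum_(i < n) (c i)%:E * (f i x)%:E)%E)).
  by move=> x _ /=; rewrite -sumEFin.
by apply: integrable_sum => // i _; exact: (integrableZl mD (c i) (fi i)).
Qed.

Arguments integrable_lincomb {d T R m D} n c f.

Lemma Rintegral_lincomb d (T : measurableType d) (R : realType)
    (m : {measure set T -> \bar R}) (D : set T) (n : nat) (c : nat -> R)
    (f : nat -> T -> R) :
  measurable D -> (forall i, m.-integrable D (EFin \o f i)) ->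
  \int[m]_(x in D) (\sum_(i < n) c i * f i x) =
  \sum_(i < n) c i * \int[m]_(x in D) f i x.
Proof.
move=> mD fi; elim: n => [|n IHn].
  under eq_Rintegral do rewrite big_ord0.
  by rewrite big_ord0 Rintegral_cst// mul0r.
under eq_Rintegral do rewrite big_ord_recr /=.
rewrite RintegralD//; last 2 first.
- exact: integrable_lincomb.
- by apply: eq_integrable (integrableZl mD (c n) (fi n)).
by rewrite IHn RintegralZl// big_ord_recr.
Qed.

Arguments Rintegral_lincomb {d T R m D} n c f.

(** * The Laplace transform of a square integrable function *)

Definition laplace (R : realType) (w : R -> R) (s : R) : R :=
  \int[lambda R]_(x in posline R) (expR (- (s * x)) * w x).

Definition square_integrable (R : realType) (w : R -> R) : Prop :=
  @measurable_fun _ _ (lebT R) (measurableTypeR R) (posline R) w /\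
  (lambda R).-integrable (posline R) (EFin \o (fun x => w x ^+ 2)).

Lemma integrable_expR_posline (R : realType) (s : R) : 0 < s ->
  (lambda R).-integrable (posline R) (EFin \o (fun x => expR (- (s * x)))).
Proof.
move=> s0; apply/integrableP; split.
  by apply/measurable_EFinP; exact: measurable_expRM.
under eq_integral do rewrite /= ger0_norm ?expR_ge0//.
by rewrite integral_expR_posline// ltry.
Qed.

Lemma integrable_mul_square (R : realType) (u w : R -> R) :
  square_integrable u -> square_integrable w ->
  (lambda R).-integrable (posline R) (EFin \o (fun x => u x * w x)).
Proof.
move=> [mu iu] [mw iw].
have mP := @measurable_posline R.
apply: (le_integrable mP _ _ (integrableD mP iu iw)).
  by apply/measurable_EFinP; exact: measurable_funM.
move=> x _; rewrite /= lee_fin [leRHS]ger0_norm ?addr_ge0 ?sqr_ge0//.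
rewrite ler_norml; apply/andP; split; nra.
Qed.

Lemma square_integrable_expR (R : realType) (s : R) : 0 < s ->
  square_integrable (fun x => expR (- (s * x))).
Proof.
move=> s0; split; first exact: measurable_expRM.
have mP := @measurable_posline R.
have s20 : 0 < s + s by rewrite addr_gt0.
apply: eq_integrable (integrable_expR_posline s20); first by [].
move=> x _ /=.
by rewrite expr2 -expRD; congr (expR _)%:E; ring.
Qed.

Lemma square_integrable_sum (R : realType) (n : nat) (c : nat -> R)
    (f : nat -> R -> R) : (forall i, square_integrable (f i)) ->
  square_integrable (fun x => \sum_(i < n) c i * f i x).
Proof.
move=> fi; have mP := @measurable_posline R; split.
  apply: measurable_sum => i.
  by apply: measurable_funM => //; exact: (fi i).1.
apply: (@eq_integrable _ _ _ (lambda R) (posline R) mP (EFin \o (fun x =>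
    \sum_(i < n) c i * (\sum_(j < n) c j * (f i x * f j x))))).
  move=> x _ /=; rewrite expr2 mulr_suml; congr EFin; apply: eq_bigr => i _.
  rewrite -mulrA; congr (_ * _); rewrite mulr_sumr; apply: eq_bigr => j _.
  by rewrite mulrCA.
apply: (integrable_lincomb (m := lambda R) n c
  (fun i x => \sum_(j < n) c j * (f i x * f j x))) => // i.
apply: (integrable_lincomb (m := lambda R) n c
  (fun j x => f i x * f j x)) => // j.
exact: integrable_mul_square.
Qed.

(** The combination [phi] of exponentials given by [blaschke_gram] has squared
norm [1 / (2 * b 0)]. Its pairing with [w] is [c 0 * laplace w (b 0)], as the
transform vanishes at the other exponents, and [|phi w| <= phi^2 + w^2]. *)
Lemma laplace_bound (R : realType) (w : R -> R) (b : nat -> R) (n : nat) :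
  square_integrable w -> injective b -> (forall i, 0 < b i) ->
  (forall i, laplace w (b i.+1) = 0) ->
  `|\prod_(i < n) ((b 0 + b i.+1) / (b 0 - b i.+1)) * laplace w (b 0)| <=
  (2 * b 0)^-1 + \int[lambda R]_(x in posline R) (w x ^+ 2).
Proof.
move=> w2 b_inj b_gt0 Lb.
have [c [<- <-]] := blaschke_gram n b_inj b_gt0.
have mP := @measurable_posline R.
pose e i (x : R) := expR (- (b i * x)).
have e2 i : square_integrable (e i) by exact: square_integrable_expR.
pose phi x := \sum_(i < n.+1) c i * e i x.
have phi2 : square_integrable phi by exact: square_integrable_sum.
have -> : c 0 * laplace w (b 0) = \int[lambda R]_(x in posline R) (phi x * w x).
  transitivity (\int[lambda R]_(x in posline R)
      (\sum_(i < n.+1) c i * (e i x * w x))).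
    rewrite (Rintegral_lincomb (m := lambda R) n.+1 c
      (fun i x => e i x * w x))//; last first.
      by move=> i; exact: integrable_mul_square.
    rewrite big_ord_recl big1 ?addr0// => i _.
    by rewrite [X in _ * X]Lb mulr0.
  apply: eq_Rintegral => x _; rewrite mulr_suml; apply: eq_bigr => i _.
  by rewrite mulrA.
have -> : \sum_(i < n.+1) \sum_(j < n.+1) c i * c j / (b i + b j) =
    \int[lambda R]_(x in posline R) (phi x ^+ 2).
  transitivity (\int[lambda R]_(x in posline R)
      (\sum_(i < n.+1) c i * (\sum_(j < n.+1) c j * (e i x * e j x)))).
    have ie i : (lambda R).-integrable (posline R)
        (EFin \o (fun x => \sum_(j < n.+1) c j * (e i x * e j x))).
      apply: (integrable_lincomb (m := lambda R) n.+1 c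
        (fun j x => e i x * e j x)) => // j.
      exact: integrable_mul_square.
    rewrite (Rintegral_lincomb (m := lambda R) n.+1 c
      (fun i x => \sum_(j < n.+1) c j * (e i x * e j x)))//.
    apply: eq_bigr => i _.
    rewrite (Rintegral_lincomb (m := lambda R) n.+1 c
      (fun j x => e i x * e j x))//; last first.
      by move=> j; exact: integrable_mul_square.
    rewrite mulr_sumr; apply: eq_bigr => j _.
    rewrite -mulrA; congr (_ * (_ * _)).
    rewrite -[LHS]/(fine ((b i + b j)^-1)%:E).
    rewrite -integral_expR_posline ?addr_gt0//.
    by apply: eq_Rintegral => x _; rewrite /e -expRD; congr expR; ring.
  apply: eq_Rintegral => x _; rewrite expr2 mulr_suml; apply: eq_bigr => i _.
  rewrite -mulrA; congr (_ * _); rewrite mulr_sumr; apply: eq_bigr => j _.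
  by rewrite mulrCA.
have [mphi iphi] := phi2; have [mw iw] := w2.
have ipw := integrable_mul_square phi2 w2.
rewrite -RintegralD//; apply: (le_trans (le_normr_Rintegral mP ipw)).
apply: le_Rintegral => //.
- exact: integrable_norm.
- exact: (integrableD mP iphi iw).
- move=> x _; rewrite ler_norml; apply/andP; split; nra.
Qed.

(** * From infinitely many zeros to all positive reals *)

Lemma sum_le_prod (R : realFieldType) (x : nat -> R) (n : nat) :
  (forall i, 0 <= x i) -> \sum_(i < n) x i <= \prod_(i < n) (1 + x i).
Proof.
move=> x0.
suff : 1 + \sum_(i < n) x i <= \prod_(i < n) (1 + x i).
  by apply: le_trans; rewrite lerDr.
elim: n => [|n IHn]; first by rewrite !big_ord0 addr0.
rewrite !big_ord_recr /= addrA.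
apply: (@le_trans _ _ ((1 + \sum_(i < n) x i) * (1 + x n))); last first.
  by rewrite ler_wpM2r// addr_ge0.
by rewrite mulrDr mulr1 lerD2l ler_peMl// lerDl sumr_ge0.
Qed.

(** If [z] is not one of the zeros [a i], the Blaschke product at [z] tends to
infinity while its product with [laplace w z] stays bounded. *)
Lemma laplace_eq0 (R : realType) (w : R -> R) (a : nat -> R) (z : R) :
  square_integrable w -> injective a -> (forall i, 0 < a i) ->
  (forall i, laplace w (a i) = 0) ->
  (forall M, exists n, M < \sum_(i < n) (a i / (z + a i) ^+ 2)) ->
  0 < z -> laplace w z = 0.
Proof.
move=> w2 a_inj a_gt0 La a_div z0.
have [[j <-]|za] := pselect (exists j, a j = z); first exact: La.
(* [z] comes first, as the exponent that [laplace_bound] singles out. *)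
pose b i := if i is k.+1 then a k else z.
have b_inj : injective b.
  move=> [|i] [|j] //= ij; [by case: za; exists j|by case: za; exists i|].
  by rewrite (a_inj _ _ ij).
have b_gt0 i : 0 < b i by case: i.
pose K := (2 * z)^-1 + \int[lambda R]_(x in posline R) (w x ^+ 2).
have bound n : \prod_(i < n) ((z + a i) / (z - a i)) ^+ 2 * laplace w z ^+ 2 <=
    K ^+ 2.
  have Hb := @laplace_bound R w b n w2 b_inj b_gt0 La.
  rewrite prodrXl -exprMn -[leLHS]real_normK ?num_real//.
  by rewrite lerXn2r// nnegrE (le_trans (normr_ge0 _) Hb).
have factor i : 1 + 4 * z * (a i / (z - a i) ^+ 2) =
    ((z + a i) / (z - a i)) ^+ 2.
  have zai : z - a i != 0.
    by rewrite subr_eq0; apply/eqP => zai; apply: za; exists i.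
  by field.
apply/eqP; rewrite -sqrf_eq0; apply/negPn/negP => Lz.
have Lz0 : 0 < laplace w z ^+ 2 by rewrite lt_def Lz sqr_ge0.
have [n] := a_div (K ^+ 2 / (4 * z * laplace w z ^+ 2)).
have z40 : 0 < 4 * z by lra.
have den0 : 0 < 4 * z * laplace w z ^+ 2 by rewrite pmulr_rgt0.
rewrite ltr_pdivrMr// => /lt_le_trans /(_ _) Kn.
suff /Kn : (\sum_(i < n) a i / (z + a i) ^+ 2) *
    (4 * z * laplace w z ^+ 2) <= K ^+ 2.
  by rewrite ltxx.
apply: le_trans (bound n); rewrite mulrA ler_wpM2r ?sqr_ge0//.
under [leRHS]eq_bigr do rewrite -factor.
apply: le_trans (sum_le_prod
  (x := fun i => 4 * z * (a i / (z - a i) ^+ 2)) n _).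
  rewrite mulr_suml; apply: ler_sum => i _; rewrite [leLHS]mulrC.
  rewrite ler_wpM2l ?(ltW z40)// ler_wpM2l ?(ltW (a_gt0 i))//.
  rewrite lef_pV2 ?posrE.
  - by rewrite -subr_ge0; have := a_gt0 i; nra.
  - by rewrite exprn_gt0// addr_gt0.
  - rewrite lt_def sqr_ge0 andbT sqrf_eq0 subr_eq0.
    by apply/eqP => zai; apply: za; exists i.
move=> i; apply: mulr_ge0; first exact: ltW.
by apply: divr_ge0; [exact: ltW|exact: sqr_ge0].
Qed.

(** Write [a = p - 1/2]. Both kinds of terms of the hypothesis are at most
[(2 z + 1)^2 * a / (z + a)^2]: if [p > 1] then [a > 1/2], so the
term is at most [1 / a] and [z + a <= (2 z + 1) a]; if [p < 1] then [a < 1/2],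
so the term is at most [4 a] and [z + a <= (2 z + 1) / 2]. *)
Lemma moments_diverge (R : realType) (p : nat -> R) (z : R) :
  (forall j, 1 / 2 < p j) ->
  (\sum_(0 <= j <oo | (1 < p j)%R) (1 / p j)%:E
      + \sum_(0 <= j <oo | ((1 / 2 < p j) && (p j < 1))%R)
          ((2 * p j - 1) / p j)%:E = +oo)%E ->
  0 < z -> forall M, exists n,
    M < \sum_(i < n) ((p i - 1 / 2) / (z + (p i - 1 / 2)) ^+ 2).
Proof.
move=> p_gt p_div z0 M.
apply: contrapT => /forallNP bnd.
pose a i := p i - 1 / 2.
have a0 i : 0 < a i by rewrite subr_gt0.
have ap i : p i = a i + 1 / 2 by rewrite /a subrK.
have za i : 0 < (z + a i) ^+ 2 by apply: exprn_gt0; exact: addr_gt0.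
pose t i := a i / (z + a i) ^+ 2.
have t0 i : 0 <= t i by rewrite divr_ge0 ?sqr_ge0 ?ltW.
pose K := (2 * z + 1) ^+ 2.
have K0 : 0 <= K by exact: sqr_ge0.
have series_bound (P : pred nat) (u : nat -> R) :
    (forall i, P i -> 0 <= u i <= K * t i) ->
    (\sum_(0 <= j <oo | P j) (u j)%:E <= (K * M)%:E)%E.
  move=> uP; apply: lime_le.
    apply: is_cvg_nneseries_cond => i _ Pi.
    by rewrite lee_fin; case/andP: (uP i Pi).
  apply: nearW => n; rewrite sumEFin lee_fin big_mkcond big_mkord.
  apply: (@le_trans _ _ (\sum_(i < n) K * t i)).
    apply: ler_sum => i _; case: ifPn => Pi; last exact: mulr_ge0.
    by case/andP: (uP i Pi).
  by rewrite -mulr_sumr ler_wpM2l// leNgt; exact/negP/bnd.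
have b1 := series_bound (fun j => 1 < p j) (fun j => 1 / p j).
have b2 := series_bound (fun j => (1 / 2 < p j) && (p j < 1))
  (fun j => (2 * p j - 1) / p j).
suff : (+oo <= (K * M)%:E + (K * M)%:E)%E by rewrite -EFinD leye_eq.
rewrite -p_div; apply: leeD.
- apply: b1 => i p1; have pi0 : 0 < p i by lra.
  apply/andP; split; first by rewrite divr_ge0// ltW.
  rewrite /t /K mulrA ler_pdivlMr// mulrAC mul1r ler_pdivrMr//.
  move: (a0 i); rewrite !ap in p1 *; move: (a i) p1 => c p1 c0.
  have : z + c <= (2 * z + 1) * c by nra.
  nra.
- apply: b2 => i /andP[_ p1]; have pi0 : 0 < p i.
    by move: (a0 i); rewrite ap; lra.
  apply/andP; split; first by rewrite divr_ge0 ?ltW//; have := p_gt i; lra.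
  rewrite /t /K mulrA ler_pdivlMr// mulrAC ler_pdivrMr//.
  move: (a0 i); rewrite !ap in p1 *; move: (a i) p1 => c p1 c0.
  nra.
Qed.

(** * Functions with vanishing integrals over rays *)

(** Rays are stable under intersection and generate the Borel sets, so the
integral of [g] vanishes over all Borel sets; a Lebesgue measurable set differs
from a Borel set by a null set. *)
Lemma ae_eq0_of_rays (R : realType) (g : R -> \bar R) :
  (lambda R).-integrable (posline R) g ->
  (forall T : R, 0 <= T ->
    (\int[lambda R]_(x in (`]T, +oo[%classic : set (lebT R))) g x = 0)%E) ->
  {ae lambda R, forall x, posline R x -> g x = 0%E}.
Proof.
move=> gi g_ray; have mP := @measurable_posline R.
have borelE : @measurable _ (measurableTypeR R) = <<s @RGenOInfty.G R >>.
  exact: RGenOInfty.measurableE.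
have caraE : @measurable _ (lebT R) =
    @completed_algebra_gen _ (measurableTypeR R) R (@lebesgue_measure R).
  by rewrite -g_sigma_completed_algebra_genE completed_caratheodory_measurable.
have mB A : @measurable _ (measurableTypeR R) A ->
    @measurable _ (lebT R) (A `&` posline R).
  by move=> mA; apply: measurableI => //; exact: measurable_borel_lebesgue.
have giB A : @measurable _ (measurableTypeR R) A ->
    (lambda R).-integrable (A `&` posline R) g.
  by move=> mA; apply: integrableS gi => //; exact: mB.
have borel0 (A : set R) : @measurable _ (measurableTypeR R) A ->
    (\int[lambda R]_(x in A `&` posline R) g x = 0)%E.
  rewrite borelE; move: A.
  apply: (@dynkin_induction _ (measurableTypeR R) (@RGenOInfty.G R)
    (fun A =>
      (\int[lambda R]_(x in (A : set (lebT R)) `&` posline R) g x = 0)%E)).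
  - exact: borelE.
  - move=> _ _ [x ->] [y ->]; exists (Num.max x y).
    by rewrite predeqE => z /=; rewrite !in_itv/= !andbT gt_max; split => /andP.
  - by rewrite setTI; apply: g_ray.
  - move=> _ [x ->].
    rewrite (_ : _ `&` _ = `]Num.max x 0, +oo[%classic); last first.
      rewrite /posline predeqE => z /=.
      by rewrite !in_itv/= !andbT gt_max; split => /andP.
    by apply: g_ray; rewrite le_max lexx orbT.
  - move=> S mS S0.
    have := g_ray 0 (lexx _).
    rewrite -[X in integral _ X _](setTI (posline R)) -(setUv S) setIUl.
    rewrite integral_setU.
    + by rewrite S0 add0e.
    + exact: mB.
    + by apply: mB; exact: measurableC.
    + by rewrite -setIUl setUv setTI; exact: measurable_int gi.
    + by apply/disj_setPS => x [] [Sx _] [].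
  - move=> F mF tF F0.
    rewrite setI_bigcupl integral_bigcup.
    + by apply: eseries0 => i _ _; exact: F0.
    + by apply: trivIset_setIr.
    + by move=> k; exact: mB.
    + by rewrite -setI_bigcupl; apply: giB; exact: bigcupT_measurable.
apply: (@integral_ae_eq _ _ _ (lambda R) (posline R) mP (cst 0%E) g gi) => //.
move=> E ED mE; rewrite integral0.
have := mE; rewrite caraE => -[X mX [N [N' [mN' N'0 NN'] XN]]].
have mN'' : @measurable _ (lebT R) N' by exact: measurable_borel_lebesgue.
rewrite (@negligible_integral _ _ _ _ E N')//; last first.
  by apply: integrableS gi.
have -> : E `\` N' = (X `\` N') `&` posline R.
  rewrite -XN predeqE => x /=; split.
    move=> [[Xx|/NN' //] nN]; split => //; apply: ED; rewrite -XN; by left.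
  by move=> [[Xx nN] _]; split => //; left.
by apply: borel0; exact: measurableD.
Qed.

(** * Uniqueness for the Laplace transform *)

Lemma bernoulli_ineq (R : realDomainType) (y : R) (n : nat) :
  -1 <= y -> 1 + n%:R * y <= (1 + y) ^+ n.
Proof.
move=> y1; elim: n => [|n IHn]; first by rewrite mul0r addr0 expr0.
rewrite exprS; apply: (@le_trans _ _ ((1 + y) * (1 + n%:R * y))).
  have : 0 <= n%:R :> R by [].
  rewrite -natr1; nra.
by rewrite ler_wpM2l// -lerBlDl sub0r.
Qed.

(** By Bernoulli's inequality the sequence is at least [1 - 2^n q^n]. *)
Lemma cvg_expn_step_lt (R : realType) (q : R) : 0 <= q < 1 / 2 ->
  ((1 - q ^+ n) ^+ (2 ^ n)) @[n --> \oo] --> (1 : R).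
Proof.
move=> /andP[q0 q2].
have qn n : 0 <= q ^+ n <= 1 by rewrite exprn_ge0//= exprn_ile1//; lra.
apply: (@squeeze_cvgr _ _ _ _ (fun n => 1 - (2 * q) ^+ n) (cst 1)).
- apply: nearW => n /=; apply/andP; split; last first.
    by rewrite exprn_ile1//; have := qn n; lra.
  have := @bernoulli_ineq R (- (q ^+ n)) (2 ^ n)%N.
  by rewrite exprMn natrX mulrN; apply; have := qn n; lra.
- rewrite -[X in _ --> X]subr0; apply: cvgB; first exact: cvg_cst.
  by apply: cvg_expr; rewrite ger0_norm; lra.
- exact: cvg_cst.
Qed.

(** With [N = 2^n], Bernoulli's inequality bounds the product of
[(1 - q^n)^N] and [1 + N q^n] by [(1 - q^(2 n))^N <= 1]. *)
Lemma cvg_expn_step_gt (R : realType) (q : R) : 1 / 2 < q <= 1 ->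
  ((1 - q ^+ n) ^+ (2 ^ n)) @[n --> \oo] --> (0 : R).
Proof.
move=> /andP[q2 q1]; have q0 : 0 < q by lra.
have qn n : 0 <= q ^+ n <= 1 by rewrite exprn_ge0 ?exprn_ile1 ?(ltW q0).
apply: (@squeeze_cvgr _ _ _ _ (cst 0) (fun n => ((2 * q)^-1) ^+ n)).
- apply: nearW => n /=; apply/andP; split.
    by rewrite exprn_ge0//; have := qn n; lra.
  rewrite exprVn -div1r ler_pdivlMr; last by rewrite exprn_gt0//; lra.
  apply: (@le_trans _ _ ((1 - q ^+ n) ^+ (2 ^ n) * (1 + q ^+ n) ^+ (2 ^ n))).
    rewrite ler_wpM2l//; first by rewrite exprn_ge0//; have := qn n; lra.
    have := @bernoulli_ineq R (q ^+ n) (2 ^ n)%N.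
    by rewrite exprMn natrX => H; apply: le_trans (H _); have := qn n; lra.
  rewrite -exprMn exprn_ile1//; have := qn n; nra.
- exact: cvg_cst.
- apply: cvg_expr; rewrite ger0_norm ?invr_ge0; last lra.
  by rewrite invf_lt1; lra.
Qed.

(** Expanding the power turns the integral into a combination of values of the
Laplace transform of [w]; the induction on [m] does this one factor at a time,
for all [s] at once. *)
Lemma laplace_binomial_eq0 (R : realType) (w : R -> R) (d : R) (m : nat) :
  square_integrable w -> (forall s, 0 < s -> laplace w s = 0) -> 0 <= d ->
  forall s, 0 < s ->
  (lambda R).-integrable (posline R) (EFin \o (fun x =>
    (1 - expR (- (d * x))) ^+ m * (expR (- (s * x)) * w x))) /\
  \int[lambda R]_(x in posline R)
    ((1 - expR (- (d * x))) ^+ m * (expR (- (s * x)) * w x)) = 0.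
Proof.
move=> w2 Lw d0; have mP := @measurable_posline R.
elim: m => [|m IHm] s s0.
  split.
    apply: eq_integrable (integrable_mul_square (square_integrable_expR s0) w2).
    - exact: mP.
    - by move=> x _ /=; rewrite expr0 mul1r.
  by rewrite -(Lw s s0); apply: eq_Rintegral => x _; rewrite expr0 mul1r.
have [i1 e1] := IHm s s0.
have [i2 e2] := IHm (s + d) (ltr_wpDr d0 s0).
have stepE x : (1 - expR (- (d * x))) ^+ m.+1 * (expR (- (s * x)) * w x) =
    (1 - expR (- (d * x))) ^+ m * (expR (- (s * x)) * w x) -
    (1 - expR (- (d * x))) ^+ m * (expR (- ((s + d) * x)) * w x).
  have -> : - ((s + d) * x) = - (s * x) + - (d * x) by ring.
  by rewrite expRD exprS; ring.
split.
  by apply: eq_integrable (integrableB mP i1 i2) => // x _ /=; rewrite stepE.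
under eq_Rintegral do rewrite stepE.
by rewrite RintegralB// e1 e2 subrr.
Qed.

(** The weight [exp (- x)] makes [w] integrable, which gives the dominating
function. *)
Lemma laplace_ray_eq0 (R : realType) (w : R -> R) (T : R) :
  square_integrable w -> (forall s, 0 < s -> laplace w s = 0) -> 0 <= T ->
  (\int[lambda R]_(x in (`]T, +oo[%classic : set (lebT R)))
    (expR (- (1 * x)) * w x)%:E = 0)%E.
Proof.
move=> w2 Lw; have mP := @measurable_posline R.
have gi := integrable_mul_square (square_integrable_expR ltr01) w2.
have [mw _] := w2.
have mg := measurable_int _ gi.
rewrite le_eqVlt => /predU1P[<-|T0].
  have := integrable_fin_num mP gi => /fineK <-.
  exact: congr1 (Lw 1 ltr01).
pose c := ln 2 / T.
have c0 : 0 < c by rewrite divr_gt0// ln_gt0// ltr1n.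
have cT : c * T = ln 2 by rewrite /c divfK// gt_eqF.
pose g x := expR (- (1 * x)) * w x.
pose ray : set (lebT R) := `]T, +oo[%classic.
have mray : measurable ray.
  by apply: measurable_borel_lebesgue; exact: measurable_itv.
pose f_ n x : \bar R := ((1 - expR (- ((n%:R * c) * x))) ^+ (2 ^ n) * g x)%:E.
have nc0 n : 0 <= n%:R * c by rewrite mulr_ge0// ltW.
have -> : (`]T, +oo[%classic : set (lebT R)) = posline R `&` ray.
  rewrite predeqE => x; rewrite /posline /ray /= !in_itv/= !andbT.
  split => [Tx|[]//].
  by split => //; exact: lt_trans Tx.
rewrite integral_mkcondr.
have f_0 n : (\int[lambda R]_(x in posline R) f_ n x = 0)%E.
  have [i e] := laplace_binomial_eq0 (2 ^ n) w2 Lw (nc0 n) ltr01.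
  by rewrite -[LHS]fineK ?[fine _]e//; exact: integrable_fin_num.
have qE n x : expR (- ((n%:R * c) * x)) = expR (- (c * x)) ^+ n.
  by rewrite -expRM_natl; congr expR; ring.
have expcT : expR (- (c * T)) = 1 / 2 :> R.
  by rewrite cT expRN lnK ?posrE// div1r.
have [||||_ _ lim] := @dominated_convergence _ _ _ (lambda R) (posline R) mP f_
  ((EFin \o g) \_ ray) (fun x => `|(g x)%:E|)%E _ _ _ (integrable_abse gi).
- move=> n; have [i _] := laplace_binomial_eq0 (2 ^ n) w2 Lw (nc0 n) ltr01.
  exact: measurable_int i.
- apply/measurable_restrict => //.
  by apply: measurable_funS mg => //; exact: subIsetl.
(* The powers tend to the indicator of [ray] except at [T], where their limit
is [1 / e]. *)
- exists [set T]; split.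
  + by apply: measurable_borel_lebesgue; exact: measurable_set1.
  + exact: (@lebesgue_measure_set1 R T).
  + move=> x /= nx; apply: contrapT => /= xT; apply: nx => x0.
    move: x0; rewrite /posline /= in_itv/= andbT => x0.
    rewrite /f_ patchE; case: ifPn => [|];
      rewrite /ray ?notin_setE ?inE /= in_itv/= andbT => xray.
    * apply: cvg_EFin; first exact: nearW.
      rewrite -[X in _ --> X]mul1r; apply: cvgMl.
      under eq_fun do rewrite qE.
      apply: cvg_expn_step_lt; rewrite expR_ge0 -expcT ltr_expR ltrN2.
      by rewrite ltr_pM2l.
    * have {xray}xT' : x < T.
        rewrite lt_neqAle leNgt; apply/andP.
        by split => //; [exact/eqP|exact/negP].
      apply: cvg_EFin; first exact: nearW.
      rewrite -[X in _ --> X](mul0r (g x)); apply: cvgMl.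
      under eq_fun do rewrite qE.
      apply: cvg_expn_step_gt; rewrite -expcT ltr_expR ltrN2 ltr_pM2l// xT'/=.
      by rewrite expR_le1 oppr_le0 mulr_ge0// ltW.
- apply: aeW => x n x0; rewrite /f_ EFinM abseM; apply: gee_pMl => //.
  move: x0; rewrite /posline /= in_itv/= andbT => x0.
  have e1 : expR (- ((n%:R * c) * x)) <= 1.
    by rewrite expR_le1 oppr_le0; exact: mulr_ge0 (nc0 n) (ltW x0).
  have e0 := expR_ge0 (- ((n%:R * c) * x)).
  rewrite lee_fin ger0_norm ?exprn_ge0 ?exprn_ile1//; lra.
rewrite -(cvg_lim _ lim)//; apply: lim_near_cst => //.
by apply: nearW => n; exact: f_0.
Qed.

Lemma laplace_injective (R : realType) (w : R -> R) :
  square_integrable w -> (forall s, 0 < s -> laplace w s = 0) ->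
  {ae lambda R, forall x, posline R x -> w x = 0}.
Proof.
move=> w2 Lw.
have gi := integrable_mul_square (square_integrable_expR ltr01) w2.
have := ae_eq0_of_rays gi (fun T => laplace_ray_eq0 w2 Lw (T := T)).
apply: filterS => x gx /gx /= [] /eqP.
by rewrite mulf_eq0 gt_eqF ?expR_gt0//= => /eqP.
Qed.

Lemma square_integrableB (R : realType) (u v : R -> R) :
  square_integrable u -> square_integrable v ->
  square_integrable (fun x => u x - v x).
Proof.
move=> [mu iu] [mv iv]; have mP := @measurable_posline R.
split; first exact: measurable_funB.
have iuv := integrableD mP iu iv.
apply: (le_integrable mP _ _ (integrableD mP iuv iuv)).
  by apply/measurable_EFinP; apply: measurable_funX; exact: measurable_funB.
move=> x _; rewrite /= lee_fin ger0_norm ?sqr_ge0//.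
apply: le_trans (ler_norm _); have := sqr_ge0 (u x + v x); nra.
Qed.

Lemma laplaceB (R : realType) (u v : R -> R) (s : R) :
  square_integrable u -> square_integrable v -> 0 < s ->
  laplace (fun x => u x - v x) s = laplace u s - laplace v s.
Proof.
move=> u2 v2 s0; have e2 := square_integrable_expR s0.
rewrite /laplace -RintegralB//.
- by apply: eq_Rintegral => x _; rewrite mulrBr.
- exact: measurable_posline.
- exact: integrable_mul_square.
- exact: integrable_mul_square.
Qed.

(** * The moment problem *)

(** [f] is in the weighted space iff [unweight f] is square integrable for
Lebesgue measure; this moves the moments to the exponents [p j - 1/2]. *)
Definition unweight (R : realType) (f : R -> R) (x : R) : R :=
  expR (- (1 / 2 * x)) * f x.

Lemma square_integrable_unweight (R : realType) (f : R -> R) :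
  L2rho f -> square_integrable (unweight f).
Proof.
move=> [mf fi]; have mw : measurable_fun (posline R) (unweight f).
  by apply: measurable_funM => //; exact: measurable_expRM.
split=> //; apply/integrableP; split.
  by apply/measurable_EFinP; apply: measurable_funX.
apply: le_lt_trans fi; rewrite /integral_posline le_eqVlt; apply/predU1l.
apply: eq_integral => x _; rewrite /= ger0_norm ?sqr_ge0//; congr EFin.
rewrite real_normK ?num_real// exprMn mulrC [X in _ * X = _]expr2 -expRD.
congr (_ * expR _).
by field.
Qed.

Lemma laplace_unweight (R : realType) (p m : nat -> R) (f : R -> R) (j : nat) :
  solves_moments p m f -> laplace (unweight f) (p j - 1 / 2) = m j.
Proof.
move=> /(_ j) fE; rewrite -[RHS]/(fine (m j)%:E) -fE.
apply: eq_Rintegral => x _; rewrite /unweight mulrA -expRD.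
by congr (expR _ * _); field.
Qed.

Unset Implicit Arguments.
Set Strict Implicit.
Set Printing Implicit Defensive.

Theorem theorem1 (R : realType) (p mu : nat -> R)
    (p_inj : injective p)
    (p_gt : forall j, 1 / 2 < p j)
    (p_div : (\sum_(0 <= j <oo | (1 < p j)%R) (1 / p j)%:E
      + \sum_(0 <= j <oo | ((1 / 2 < p j) && (p j < 1))%R)
          ((2 * p j - 1) / p j)%:E = +oo)%E)
    (f g : R -> R)
    (f_L2 : L2rho f) (f_sol : solves_moments p mu f)
    (g_L2 : L2rho g) (g_sol : solves_moments p mu g) :
  eq_L2rho f g.
Proof.
have f2 := square_integrable_unweight f_L2.
have g2 := square_integrable_unweight g_L2.
have w2 := square_integrableB f2 g2.
have a_gt0 j : 0 < p j - 1 / 2 by rewrite subr_gt0.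
have Lw z : 0 < z -> laplace (fun x => unweight f x - unweight g x) z = 0.
  move=> z0; apply: (laplace_eq0 (a := fun j => p j - 1 / 2) w2) => //.
  - by move=> i j /addIr /p_inj.
  - move=> j; rewrite laplaceB// (laplace_unweight _ f_sol).
    by rewrite (laplace_unweight _ g_sol) subrr.
  - exact: moments_diverge.
have := laplace_injective w2 Lw.
apply: filterS => x wx /wx /eqP.
by rewrite -mulrBr mulf_eq0 gt_eqF ?expR_gt0//= subr_eq0 => /eqP.
Qed.
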